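(* Let $G$ be a countably infinite group with identity $e$ such that for each $g\in G\setminus\{e\}$ the set $\{x\in G:x^2=g\}$ is finite. Then there exists a subset $A\subseteq G$ such that $A\subsetneq\Delta(A)\subsetneq\Delta^2(A)\subsetneq\Delta^3(A)\subsetneq\cdots$.
   Context: For $A\subseteq G$, $\Delta(A)=\{g\in G:|gA\cap A|=\infty\}$, and $\Delta^{k+1}(A)=\Delta(\Delta^k(A))$ with $\Delta^1=\Delta$. *)

(* Defs.v *)
From mathcomp Require Import all_boot.
From mathcomp Require Import boolp classical_sets functions cardinality.
Set Implicit Arguments.
Unset Strict Implicit.
Unset Printing Implicit Defensive.

Local Open Scope classical_set_scope.
Local Open Scope group_scope.

Definition ltranslate (G : groupType) (g : G) (A : set G) : set G :=
  [set g * x | x in A].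

Definition Delta (G : groupType) (A : set G) : set G :=
  [set g | infinite_set (ltranslate g A `&` A)].

(* Main.v *)
(** Build sets B_0 < B_1 < ... with Delta B_k = B_(k+1) and take A = B_0.  At
    stage n a target h, already present in B_(k+1), is given two new
    representatives x and h x of its "difference" (h x) x^-1 = h; they and
    their inverses are put into B_k and all later sets.  Every pair (h, k) with
    h in B_(k+1) recurs infinitely often, so B_(k+1) is contained in Delta B_k.
    Conversely x is chosen so that, among the first n elements of G, the only
    quotients of elements created at stage n are 1, h and h^-1, and none is a
    quotient of a new element and an old one; then any g in Delta B_k is 1 or
    some h or h^-1 in B_(k+1).  The quotients to be controlled are x^2, h x^2,
    x h x, (h x)^2, excluded off a finite set by finiteness of square roots,
    and the conjugate x^-1 h x, which is h for x in the centralizer of h and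
    takes each value finitely often if that centralizer is finite. *)

Require Import Defs.
From mathcomp Require Import all_boot.
From mathcomp Require Import boolp classical_sets functions cardinality.
Set Implicit Arguments.
Unset Strict Implicit.
Unset Printing Implicit Defensive.

Local Open Scope classical_set_scope.
Local Open Scope group_scope.

(** * Recursive choice and recurrent enumeration *)

Lemma finite_preimage_inj (T U : Type) (f : T -> U) (B : set U) :
  injective f -> finite_set B -> finite_set (f @^-1` B).
Proof. by move=> fI; apply: finite_preimage => x y _ _; apply: fI. Qed.

(** Since [R n u] sees only the values of [u] below [n], the history can be kept as a finite list,
    padded with [t0], and a choice function on lists iterated. *)
Lemma history_choice (T : Type) (t0 : T) (R : nat -> (nat -> T) -> T -> Prop) :
  (forall n u v t, (forall m, m < n -> u m = v m) -> R n u t -> R n v t) ->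
  (forall n u, exists t, R n u t) -> exists u, forall n, R n u (u n).
Proof.
move=> Rlocal Rtotal.
have /choice[next nextP] (s : seq T) := Rtotal (size s) (nth t0 s).
pose hist n := iter n (fun s => rcons s (next s)) [::].
pose u n := next (hist n); exists u => n.
have histE : hist n = mkseq u n by elim: n => // n IH; rewrite mkseqS -IH.
have := nextP (hist n); rewrite -/(u n) histE size_mkseq; apply: Rlocal => m mn.
by rewrite nth_mkseq.
Qed.

(** Natural numbers are decoded as pairs; the first component selects the element, and the free
    second one makes it recur. *)
Lemma recurrent_enum (T : choiceType) (x0 : T) : countable [set: T] ->
  exists s : nat -> T, forall t N, exists2 n, N <= n & s n = t.
Proof.
move=> /countable_injP[f fI].
exists (fun n => if @unpickle (nat * nat)%type n is Some (i, _)
                 then xget x0 [set t | f t = i] else x0) => t N.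
pose code j : nat := pickle (f t, j : nat).
have codeI : injective code by move=> i j /(pcan_inj pickleK)[].
have [j Nj] : exists j, N <= code j.
  apply: contrapT => small; apply: infinite_nat.
  have -> : [set: nat] = code @^-1` `I_N.
    apply/seteqP; split=> // j _ /=; rewrite ltnNge; apply/negP => Nj.
    by apply: small; exists j.
  exact: finite_preimage_inj (finite_II N).
exists (code j) => //; rewrite /code pickleK.
by apply: fI; rewrite ?inE //; apply: (@xgetPex _ x0 [set t' | f t' = f t]); exists t.
Qed.

(** * Choosing one block *)

Section Blocks.
Variable G : groupType.
Implicit Types (g y z : G) (E F : set G).

Definition block (h x : G) : seq G := [:: x; h * x; x^-1; (h * x)^-1].

Lemma block_inv h x y : y \in block h x -> y^-1 \in block h x.
Proof.
by rewrite !inE => /or4P[]/eqP->; rewrite ?invgK eqxx ?orbT.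
Qed.

Lemma infinite_conj_avoid F h : infinite_set [set: G] -> finite_set F ->
  exists2 S : set G, infinite_set S &
    finite_set [set x | S x /\ F (x^-1 * (h * x)) /\ x^-1 * (h * x) <> h].
Proof.
move=> Ginf Ffin.
have [Cfin|Cinf] := pselect (finite_set [set c : G | h * c = c * h]); last first.
  exists [set c | h * c = c * h] => //.
  apply: sub_finite_set (finite_set0 G) => x [/= xh []].
  by rewrite xh mulKg.
exists [set: G] => //.
pose D f := [set x | h * x = x * f].
apply: (@sub_finite_set _ _ (\bigcup_(f in F) D f)).
  by move=> x [_ [Fx _]]; exists (x^-1 * (h * x)) => //=; rewrite /D /= mulVKg.
apply: bigcup_finite => // f _.
have [[x0 x0f]|none] := pselect (exists x0, D f x0); last first.
  by apply: sub_finite_set (finite_set0 G) => x xf; apply: none; exists x.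
(* All solutions of [h * x = x * f] lie in one right coset, through [x0], of the finite centralizer
   of [h]. *)
have : finite_set ((fun x => x * x0^-1) @^-1` [set c | h * c = c * h]).
  by apply: finite_preimage_inj => // x y /mulIg.
apply: sub_finite_set => x /= xf; rewrite mulgA xf -!mulgA; congr (x * _).
by apply: (@mulgI _ x0); apply: (@mulIg _ x0); rewrite !mulgA mulgVK mulgV mul1g x0f.
Qed.

Lemma finite_square_in F :
  (forall g, g <> 1 -> finite_set [set x | x ^+ 2 = g]) -> finite_set F ->
  finite_set [set x | F (x * x) /\ x * x <> 1].
Proof.
move=> roots Ffin.
apply: (@sub_finite_set _ _ (\bigcup_(g in F `\ 1) [set x | x ^+ 2 = g])).
  by move=> x [Fx x1]; exists (x * x).
by apply: bigcup_finite => [|g [_ g1]]; [apply: finite_setD | apply: roots].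
Qed.

(** Up to inversion, a quotient of two block elements is 1, [h], or one of the five products bounded
    in [c1] to [c5]. *)
Lemma fresh_block E F h : infinite_set [set: G] ->
  (forall g, g <> 1 -> finite_set [set x | x ^+ 2 = g]) ->
  finite_set E -> finite_set F ->
  exists x, (forall y, y \in block h x -> ~ E y) /\
    (forall y z, y \in block h x -> z \in block h x ->
       F (y * z^-1) -> y * z^-1 \in [:: 1; h; h^-1]).
Proof.
move=> Ginf roots Efin Ffin'.
pose F' := F `|` (fun g => g^-1) @^-1` F.
have F'V y : F' y^-1 -> F' y by rewrite /F' /= invgK => -[]; [right|left].
have F'fin : finite_set F'.
  by rewrite finite_setU; split => //; apply: finite_preimage_inj => //; apply: invg_inj.
have [S Sinf Sconj] := infinite_conj_avoid h Ginf F'fin.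
(* Square 1 is tolerated, as 1 may have infinitely many roots: if [x] or [h * x] squares to 1, the
   affected products become 1, [h] or [h^-1]. *)
pose Q A := [set x : G | A (x * x) /\ x * x <> 1].
have Qfin A : finite_set A -> finite_set (Q A) by apply: finite_square_in.
have hfin k A : finite_set A -> finite_set ((fun x : G => k * x) @^-1` A).
  by apply: finite_preimage_inj; apply: mulgI.
have Vfin A : finite_set A -> finite_set ((fun x : G => x^-1) @^-1` A).
  by apply: finite_preimage_inj; apply: invg_inj.
have fU (A B : set G) : finite_set A -> finite_set B -> finite_set (A `|` B).
  by rewrite finite_setU.
pose B1 := E `|` (fun x => x^-1) @^-1` E.
(* [B2] constrains [h * x] and [B3] constrains [x]: the mixed products reduce to squares, as
   [x * (h * x)] is [h^-1] times the square of [h * x], and [h * x * x] is [h] times that of [x]. *)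
pose B2 := B1 `|` Q F' `|` Q ((fun x => h^-1 * x) @^-1` F').
pose B3 := Q F' `|` Q ((fun x => h * x) @^-1` F').
have bad_fin : finite_set
  (B1 `|` B3 `|` (fun x => h * x) @^-1` B2 `|`
   [set x | S x /\ F' (x^-1 * (h * x)) /\ x^-1 * (h * x) <> h]).
  by do ![exact: Sconj | apply: (fU) | apply: (hfin) | apply: (Qfin) | apply: (Vfin) | done].
have [x [Sx /not_orP[/not_orP[/not_orP[xB1 xB3] xB2] xB4]]] :=
  infinite_setN0 (infinite_setD Sinf bad_fin).
have sq A y : ~ Q A y -> A (y * y) -> y * y = 1.
  by move=> nQ Ay; apply: contrapT => y1; apply: nQ.
exists x; split=> [y|y z].
  rewrite !inE => /or4P[]/eqP-> Ey.
  - by apply: xB1; left.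
  - by apply: xB2; do 2 left; left.
  - by apply: xB1; right.
  - by apply: xB2; do 2 left; right.
have c1 : F' (x * x) -> x * x = 1.
  by apply: sq => q; apply: xB3; left.
have c2 : F' (h * x * x) -> x * x = 1.
  by rewrite -mulgA => Fx; apply: (sq ((fun x => h * x) @^-1` F')) => // q; apply: xB3; right.
have c3 : F' (x * (h * x)) -> (h * x) * (h * x) = 1.
  move=> Fx; apply: (sq ((fun x => h^-1 * x) @^-1` F')) => [q|].
    by apply: xB2; right.
  by rewrite /= -mulgA mulKg.
have c4 : F' (h * x * (h * x)) -> h * x * (h * x) = 1.
  by apply: sq => q; apply: xB2; left; right.
have c5 : F' (x^-1 * (h * x)) -> x^-1 * (h * x) = h.
  by move=> Fx; apply: contrapT => nh; apply: xB4.
have c3' : F' (x * (h * x)) -> x * (h * x) = h^-1.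
  by move=> /c3; rewrite -mulgA => /mulg1_eq ->.
pose P w := F' w -> w \in [:: 1; h; h^-1].
have P1 : P 1 by rewrite /P inE eqxx.
have Ph : P h by rewrite /P !inE eqxx orbT.
have PV w : P w^-1 -> P w.
  move=> Pw Fw; have : w^-1 \in [:: 1; h; h^-1] by apply: Pw; apply: F'V; rewrite invgK.
  rewrite !inE => /or3P[]/eqP/(congr1 (fun g : G => g^-1)); rewrite invgK => ->.
  - by rewrite invg1 eqxx.
  - by rewrite eqxx !orbT.
  - by rewrite invgK eqxx orbT.
have Pxx : P (x * x) by move=> /c1->; rewrite inE eqxx.
have Phxx : P (h * x * x) by move=> Fx; rewrite -mulgA c2 // mulg1 !inE eqxx orbT.
have Pxhx : P (x * (h * x)) by move=> /c3'->; rewrite !inE eqxx !orbT.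
have Phxhx : P (h * x * (h * x)) by move=> /c4->; rewrite inE eqxx.
have Pconj : P (x^-1 * (h * x)) by move=> /c5->; rewrite !inE eqxx orbT.
suff : y \in block h x -> z \in block h x -> P (y * z^-1).
  by move=> Pyz yb zb Fyz; apply: Pyz => //; left.
have sym u v : P (u * v^-1) -> P (v * u^-1).
  by move=> Puv; apply: PV; rewrite invgF.
rewrite !inE => /or4P[]/eqP-> /or4P[]/eqP->; rewrite ?mulgV ?invgK //.
- by apply: sym; rewrite mulgK.
- by rewrite mulgK.
- by apply: PV; rewrite invgF invgK.
- by apply: PV; rewrite invgF invgK.
- by apply: PV; rewrite invgF invgK.
- by apply: PV; rewrite invgF invgK.
- by apply: PV; rewrite invgM invgK.
Qed.

(** * Levels and the recursive construction *)

Definition blocks (p : pred nat) (h x : nat -> G) : set G :=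
  [set y | y = 1 \/ exists2 m, p m & y \in block (h m) (x m)].

Definition earlier h x n := blocks (fun m => m < n) h x.

(** The set B_j of the overview: the block of stage [n] enters at index [k n] and stays. *)
Definition level h x (k : nat -> nat) j := blocks (fun n => k n <= j) h x.

Lemma sub_blocks (p q : pred nat) h x h' x' :
  (forall m, p m -> [/\ q m, h m = h' m & x m = x' m]) ->
  blocks p h x `<=` blocks q h' x'.
Proof.
move=> pq y [->|[m pm ym]]; first by left.
by right; have [qm hm xm] := pq m pm; exists m; rewrite -?hm -?xm.
Qed.

Lemma level_inv h x k j y : level h x k j y -> level h x k j y^-1.
Proof.
case=> [->|[n kn yn]]; first by left; rewrite invg1.
by right; exists n => //; apply: block_inv.
Qed.

Lemma level_le h x k i j : i <= j -> level h x k i `<=` level h x k j.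
Proof.
by move=> ij; apply: sub_blocks => m km; split=> //; apply: leq_trans ij.
Qed.

Lemma finite_earlier h x n : finite_set (earlier h x n).
Proof.
apply: (@sub_finite_set _ _
  ([set 1] `|` \bigcup_(m in `I_n) [set` block (h m) (x m)])).
  by move=> y [->|[m mn ym]]; [left|right; exists m].
rewrite finite_setU; split; first exact: finite_set1.
by apply: bigcup_finite => [|m _]; [apply: finite_II | apply: finite_seq].
Qed.

(** Here [f] numbers the group, so [n < f g] keeps [g] away from the elements numbered up to [n]. *)
Definition separated (f : G -> nat) h x := forall n y, y \in block (h n) (x n) ->
  (forall o, earlier h x n o -> [/\ y <> o, n < f (y * o^-1) & n < f (o * y^-1)]) /\
  (forall z, z \in block (h n) (x n) -> f (y * z^-1) <= n ->
     y * z^-1 \in [:: 1; h n; (h n)^-1]).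

(** Stage [n] serves the scheduled pair [s n] = (g, j) if g already lies in level j+1 as built so
    far; otherwise its target is 1, a member of every level. *)
Lemma exists_blocks (f : G -> nat) (s : nat -> G * nat) : injective f ->
  infinite_set [set: G] ->
  (forall g, g <> 1 -> finite_set [set y | y ^+ 2 = g]) ->
  exists h x, separated f h x /\
    forall n, h n =
      if `[< blocks (fun m => (m < n) && ((s m).2 <= (s n).2.+1)) h x (s n).1 >]
      then (s n).1 else 1.
Proof.
move=> fI Ginf roots.
pose target n (u : nat -> G * G) : G :=
  if `[< blocks (fun m => (m < n) && ((s m).2 <= (s n).2.+1))
           (fun m => (u m).1) (fun m => (u m).2) (s n).1 >]
  then (s n).1 else 1.
pose R n (u : nat -> G * G) (t : G * G) := t.1 = target n u /\
  forall y, y \in block t.1 t.2 ->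
  (forall o, earlier (fun m => (u m).1) (fun m => (u m).2) n o ->
     [/\ y <> o, n < f (y * o^-1) & n < f (o * y^-1)]) /\
  (forall z, z \in block t.1 t.2 -> f (y * z^-1) <= n ->
     y * z^-1 \in [:: 1; t.1; t.1^-1]).
have [||u uP] := @history_choice (G * G)%type (1, 1) R.
- move=> n u v t uv [t1 tP]; split.
    rewrite t1 /target; congr (if _ then _ else _).
    by apply: asbool_equiv_eq; split; apply: sub_blocks => m /andP[mn ->];
      rewrite mn uv.
  move=> y yt; have [yo yz] := tP y yt; split=> // o ov; apply: yo.
  by apply: sub_blocks ov => m mn; rewrite uv.
- move=> n u; pose F := f @^-1` `I_n.+1.
  have Ffin : finite_set F by apply: finite_preimage_inj (finite_II _).
  pose old := earlier (fun m => (u m).1) (fun m => (u m).2) n.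
  (* The new elements that the old element [o] rules out. *)
  pose near o := [set o] `|` (fun y => y * o^-1) @^-1` F `|` (fun y => o * y^-1) @^-1` F.
  have Efin : finite_set (\bigcup_(o in old) near o).
    apply: bigcup_finite => [|o _]; first exact: finite_earlier.
    rewrite !finite_setU; split; [split|].
    + exact: finite_set1.
    + by apply: finite_preimage_inj => //; apply: mulIg.
    + by apply: finite_preimage_inj => // y z /mulgI /invg_inj.
  have [x [xE xF]] := fresh_block (target n u) Ginf roots Efin Ffin.
  exists (target n u, x); split=> // y yx; split=> [o oold|z zx fyz]; last exact: xF.
  have /not_orP[/not_orP[yo yF] oF] : ~ near o y by move=> yo; apply: (xE y yx); exists o.
  by split=> //; rewrite ltnNge; apply/negP.
exists (fun n => (u n).1), (fun n => (u n).2); split=> n; last by case: (uP n).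
by move=> y; have [_] := uP n; apply.
Qed.

(** * Delta of a level is the next level *)

Section Levels.
Variables (f : G -> nat) (h x : nat -> G) (k : nat -> nat).
Hypothesis sep : separated f h x.
Hypothesis target_level : forall n, level h x k (k n).+1 (h n).
Hypothesis target_recurs : forall j g, level h x k j.+1 g ->
  forall N, exists n, [/\ N <= n, h n = g & k n = j].

Lemma mem_block_x n : x n \in block (h n) (x n).
Proof. by rewrite inE eqxx. Qed.

Lemma block_disjoint m n y :
  y \in block (h m) (x m) -> y \in block (h n) (x n) -> m = n.
Proof.
wlog mn : m n / m < n => [W ym yn|ym yn].
  by case: (ltngtP m n) => // /W; [apply|move=> ->].
by have [/(_ y)[] //] := sep yn; right; exists m.
Qed.

Lemma Delta_level_sub j : Delta (level h x k j) `<=` level h x k j.+1.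
Proof.
move=> g gD; pose E := earlier h x (f g).
have Dfin : finite_set (E `|` (fun y => g^-1 * y) @^-1` E).
  rewrite finite_setU; split; first exact: finite_earlier.
  by apply: finite_preimage_inj; [apply: mulgI | apply: finite_earlier].
(* Off a finite set, [a] and [g * a] both come from stages at least [f g]. Different stages would
   force the index of their quotient [g] above [f g], so the stage is shared. *)
have [_ [[[a aB <-] bB] /not_orP[bE]]] := infinite_setN0 (infinite_setD gD Dfin).
rewrite /= mulKg => aE.
have late y : level h x k j y -> ~ E y ->
    exists n, [/\ f g <= n, k n <= j & y \in block (h n) (x n)].
  move=> [->|[n kn yn]] yE; first by case: yE; left.
  exists n; split=> //; rewrite leqNgt; apply/negP => nf.
  by apply: yE; right; exists n.
have [n [gn kn an]] := late _ aB aE.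
have [m [gm _ bm]] := late _ bB bE.
have [nm|mn|nm] := ltngtP n m.
- have [/(_ a)[|_]] := sep bm; first by right; exists n.
  by rewrite mulgK ltnNge gm.
- have [/(_ (g * a))[|_ _]] := sep an; first by right; exists m.
  by rewrite mulgK ltnNge gn.
- rewrite -nm in bm; have [_ /(_ a an)] := sep bm.
  rewrite mulgK => /(_ gn).
  have hL : level h x k j.+1 (h n).
    by apply: level_le (target_level n); rewrite ltnS.
  rewrite !inE => /or3P[]/eqP-> //; first by left.
  exact: level_inv.
Qed.

Lemma sub_Delta_level j : level h x k j.+1 `<=` Delta (level h x k j).
Proof.
move=> g gL; rewrite /Delta /= => fin.
(* Each stage [n] with target [g] and index [j] puts [g * x n] into the intersection, and disjoint
   blocks make these elements distinct. *)
have : finite_set ((fun n => g * x n) @^-1`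
    (ltranslate g (level h x k j) `&` level h x k j)).
  apply: finite_preimage_inj => // m n /mulgI xmn.
  by apply: (block_disjoint (mem_block_x m)); rewrite xmn; apply: mem_block_x.
move=> /finite_seqP[s sE].
have [n [sn hn kn]] := target_recurs gL (\max_(i <- s) i).+1.
suff ns : n \in s by have := @leq_bigmax_seq _ s xpredT id n ns isT; rewrite leqNgt sn.
suff : [set` s] n by [].
rewrite -sE /=; split; [exists (x n) => //|]; right; exists n; rewrite ?kn //.
  exact: mem_block_x.
by rewrite !inE hn eqxx orbT.
Qed.

(** A stage of index [j.+1] exists, since the target 1 recurs there; its [x n] differs from 1 and
    lies in no other block. *)
Lemma level_proper j : level h x k j `<` level h x k j.+1.
Proof.
split=> [|sub]; first exact: level_le.
have [|n [_ _ kn]] := @target_recurs j.+1 1 _ 0; first by left.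
have [|x1|[m km xm]] := sub (x n); first by right; exists n; rewrite ?kn ?mem_block_x.
  have [/(_ 1)[|]] := sep (mem_block_x n); first by left.
  by rewrite x1.
by move: km; rewrite (block_disjoint xm (mem_block_x n)) kn ltnn.
Qed.

Lemma Delta_level j : Delta (level h x k j) = level h x k j.+1.
Proof. by apply/seteqP; split; [apply: Delta_level_sub | apply: sub_Delta_level]. Qed.

End Levels.
End Blocks.

(** * Scheduling the targets *)

Theorem theorem5p4 (G : groupType)
    (G_countable : countable [set: G]) (G_infinite : infinite_set [set: G])
    (finite_roots : forall g : G, g <> 1 -> finite_set [set x : G | x ^+ 2 = g]) :
  exists A : set G, forall k : nat, iter k (@Delta G) A `<` iter k.+1 (@Delta G) A.
Proof.
have /countable_injP[f fI'] := G_countable.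
have fI : injective f by move=> y z; apply: fI'; rewrite inE.
have Gnat_countable : countable [set: G * nat].
  apply/countable_injP; exists (fun p => pickle (f p.1, p.2)).
  by move=> [y i] [z j] _ _ /(pcan_inj pickleK)[/fI -> ->].
have [s srec] := recurrent_enum (1, 0) Gnat_countable.
have [h [x [sep hE]]] := exists_blocks s fI G_infinite finite_roots.
pose k n := (s n).2.
have target_level n : level h x k (k n).+1 (h n).
  rewrite hE; case: asboolP => [|_]; last by left.
  by apply: sub_blocks => m /andP[].
have target_recurs j g : level h x k j.+1 g ->
    forall N, exists n, [/\ N <= n, h n = g & k n = j].
  move=> gL N.
  (* A single block witnesses that [g] is in the level, so from stage [M] on the scheduled target
     [g] is never replaced by 1. *)
  have [M MP] : exists M, forall n, M <= n ->
      blocks (fun m => (m < n) && (k m <= j.+1)) h x g.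
    case: gL => [->|[m km gm]]; first by exists 0; left.
    by exists m.+1 => n mn; right; exists m; rewrite ?mn.
  have [n Nn sn] := srec (g, j) (maxn M N); move: Nn; rewrite geq_max => /andP[Mn Nn].
  exists n; split=> //; last by rewrite /k sn.
  by rewrite hE sn /=; case: asboolP => // -[]; apply: MP.
exists (level h x k 0) => j.
have DeltaE i : iter i (@Delta G) (level h x k 0) = level h x k i.
  by elim: i => // i IH; rewrite iterS IH (Delta_level sep).
by rewrite !DeltaE; apply: level_proper sep target_recurs j.
Qed.
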